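(* Let $\mathscr H$ be a Hilbert space, and suppose that $\mathscr K_u,\mathscr K_w\in\mathscr L(\mathscr H)$ satisfy $\mathscr K_u\ge0$ and $\mathscr K_w\ge0$ on $\mathscr H$, and $$\operatorname{ran}\mathscr K_u\subseteq\operatorname{ran}(\mathscr K_u+\mathscr K_w).$$ Then there exists $F\in\mathscr L(\mathscr H)$ that solves $$\mathscr K_u=F(\mathscr K_u+\mathscr K_w).$$ The operator $F$ is the unique solution that satisfies $$\operatorname{ran}F^*\subseteq\overline{\operatorname{ran}(\mathscr K_u+\mathscr K_w)},\qquad\ker F^*=\ker\mathscr K_u,\qquad\|F\|=\sup_{\|f\|=1}\frac{\|\mathscr K_uf\|}{\|(\mathscr K_u+\mathscr K_w)f\|},$$ where the supremum is taken over those $f$ with $(\mathscr K_u+\mathscr K_w)f\ne0$ (and equals $0$ if there are none).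
   Context: $\mathscr L(\mathscr H)$ is the space of bounded linear operators on the complex Hilbert space $\mathscr H$; $\operatorname{ran}$ and $\ker$ denote range and kernel, $\overline X$ the closure of a subspace $X\subseteq\mathscr H$, and $F^*$ the adjoint of $F$. An operator $\mathscr K$ is non-negative, $\mathscr K\ge0$, if $(\mathscr Kf,f)\ge0$ for all $f\in\mathscr H$. *)

(* Defs.v *)
From HB Require Import structures.
From mathcomp Require Import all_boot all_order all_algebra.
From mathcomp Require Import complex ring lra.
From mathcomp Require Import boolp classical_sets reals interval_inference.
From mathcomp Require Import topology normedtype.

Set Implicit Arguments.
Unset Strict Implicit.
Unset Printing Implicit Defensive.

Import Order.TTheory GRing.Theory Num.Theory.
Import numFieldNormedType.Exports.

Local Open Scope classical_set_scope.
Local Open Scope ring_scope.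
Local Open Scope complex_scope.

(* The inner product is linear in its first argument and conjugate-linear in
   the second, and it induces the norm of the complete space H. *)
HB.mixin Record isHilbert (R : realType) H & CompleteNormedModule R[i] H := {
  hdot : {dot H for Num.conj};
  hdot_normE : forall f : H, hdot f f = `|f| ^+ 2
}.

#[short(type="hilbertType")]
HB.structure Definition Hilbert (R : realType) :=
  {H of isHilbert R H & CompleteNormedModule R[i] H}.

Section Operators.
Context {R : realType} {H : hilbertType R}.
Implicit Types (A : H -> H) (f g : H).

(* For linear A, being bounded near 0 amounts to ||A f|| <= M ||f|| for all f
   and some M (see linear_boundedP), and also to continuity
   (see linear_bounded_continuous). *)
Definition bounded_operator A : Prop :=
  linear A /\ bounded_near A (nbhs (0 : H)).

(* In R[i], 0 <= z means that z is real and nonnegative. *)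
Definition nonneg_operator A : Prop := forall f, 0 <= hdot (A f) f.

(* `|f| lives in R[i]; hnorm f is the same number in R (see hnormE). *)
Definition hnorm f : R := complex.Re `|f|.

Definition opnorm A : R := sup [set hnorm (A f) | f in [set f | hnorm f <= 1]].

Definition ker A : set H := [set f | A f = 0].

(* The h below is unique, and it exists when A is bounded (see adjointP); the
   default value 0 is irrelevant for bounded operators. *)
Definition adjoint A : H -> H :=
  fun g => xget 0 [set h | forall f, hdot (A f) g = hdot f h].

End Operators.

Section Riesz.
Context {R : realType} {H : hilbertType R}.
Implicit Types (f g h v : H) (t : R).

Lemma hnormE f : (hnorm f)%:C = `|f|.
Proof. by rewrite /hnorm RRe_real// normr_real. Qed.

Lemma hnorm_ge0 f : 0 <= hnorm f.
Proof. by rewrite -ler0c hnormE. Qed.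

Let rdot f g : R := complex.Re (hdot f g).

Let rdotDl f g h : rdot (f + g) h = rdot f h + rdot g h.
Proof. by rewrite /rdot linearDl /=; case: (hdot f h); case: (hdot g h). Qed.

Let rdotC f g : rdot f g = rdot g f.
Proof. rewrite /rdot (hermC (@hdot R H)) expr0 mul1r /=; by case: (hdot g f). Qed.

Let rdotZl t f g : rdot (t%:C *: f) g = t * rdot f g.
Proof.
by rewrite /rdot linearZl_LR /=; case: (hdot f g) => a b /=; rewrite mul0r subr0.
Qed.

Let rdotDr f g h : rdot h (f + g) = rdot h f + rdot h g.
Proof. by rewrite !(rdotC h) rdotDl. Qed.

Let rdotZr t f g : rdot f (t%:C *: g) = t * rdot f g.
Proof. by rewrite !(rdotC f) rdotZl. Qed.

Let rdotNl f g : rdot (- f) g = - rdot f g.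
Proof. by rewrite -mulN1r -rdotZl rmorphN scaleN1r. Qed.

Let rdotNr f g : rdot f (- g) = - rdot f g.
Proof. by rewrite !(rdotC f) rdotNl. Qed.

Let rdotff f : rdot f f = hnorm f ^+ 2.
Proof. by rewrite /rdot hdot_normE -hnormE -rmorphXn. Qed.

Let CS_sqr f g : rdot f g ^+ 2 <= hnorm f ^+ 2 * hnorm g ^+ 2.
Proof.
have [/eqP g0|g0] := eqVneq (hnorm g) 0.
  have -> : g = 0 by apply/normr0_eq0; rewrite -hnormE (eqP g0).
  have -> : rdot f 0 = 0 by rewrite -(subrr (0 : H)) rdotDr rdotNr subrr.
  by rewrite expr0n/= mulr_ge0// sqr_ge0.
have p : 0 < hnorm g ^+ 2 by rewrite exprn_gt0// lt_neqAle eq_sym g0 hnorm_ge0.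
set r := rdot f g; set b := hnorm g ^+ 2 in p *.
have := sqr_ge0 (hnorm (f + (- (r / b))%:C *: g)).
rewrite -(rdotff (f + _)) rdotDl !rdotDr !rdotZl !rdotZr !rdotff (rdotC g f) -/r -/b.
set a := hnorm f ^+ 2.
have -> : a + - (r / b) * r + (- (r / b) * r + - (r / b) * (- (r / b) * b))
  = a - r ^+ 2 / b by field; rewrite gt_eqF.
by rewrite subr_ge0 ler_pdivrMr.
Qed.

Let CS f g : `|rdot f g| <= hnorm f * hnorm g.
Proof.
rewrite -ler_sqr ?nnegrE ?mulr_ge0 ?hnorm_ge0// real_normK ?num_real//.
by rewrite exprMn CS_sqr.
Qed.

Section functional.
Variables (phi : H -> R) (C : R).
Hypothesis phiD : forall f g, phi (f + g) = phi f + phi g.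
Hypothesis phiZ : forall t f, phi (t%:C *: f) = t * phi f.
Hypothesis phiC : forall f, `|phi f| <= C * hnorm f.

Let J f := hnorm f ^+ 2 - 2 * phi f.

Let Jlb f : - C ^+ 2 <= J f.
Proof.
rewrite /J; have := phiC f; have := ler_norm (phi f) => h1 h2.
have : 0 <= (hnorm f - C) ^+ 2 by exact: sqr_ge0.
nra.
Qed.

Let J0 : has_inf (range J).
Proof.
by split; [exists (J 0), 0|exists (- C ^+ 2) => _ [f _ <-]; exact: Jlb].
Qed.

Let m := inf (range J).

Let mJ f : m <= J f.
Proof. by apply: ge_inf; [case: J0|exists f]. Qed.

Let JD f v t : J (f + t%:C *: v) =
  J f + 2 * t * (rdot f v - phi v) + t ^+ 2 * hnorm v ^+ 2.
Proof.
rewrite /J -rdotff rdotDl !rdotDr !rdotZl !rdotZr !rdotff (rdotC v f) phiD phiZ.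
ring.
Qed.

Let mid f g : hnorm (f - g) ^+ 2 <= 2 * (J f - m) + 2 * (J g - m).
Proof.
have := mJ (f + (2^-1)%:C *: (g - f)); rewrite JD /J -!rdotff.
have phiB : phi (g - f) = phi g - phi f.
  rewrite phiD; congr (_ + _); rewrite -mulN1r -phiZ rmorphN scaleN1r //.
rewrite phiB !rdotDl !rdotDr !(rdotNl, rdotNr) !(rdotC g f).
set x := rdot f f; set y := rdot f g; set z := rdot g g.
lra.
Qed.

Let seqP k : exists f, J f < m + k.+1%:R^-1.
Proof.
have := @inf_adherent _ (range J) k.+1%:R^-1.
case; first by rewrite invr_gt0.
  exact: J0.
by move=> _ [f _ <-] Jf; exists f.
Qed.

Let s k : H := sval (cid (seqP k)).
Let sP k : J (s k) < m + k.+1%:R^-1. Proof. exact: (svalP (cid (seqP k))). Qed.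

Let near_inv (e : R) : 0 < e -> \forall k \near \oo, (k : nat).+1%:R^-1 < e.
Proof. by move=> /posnumP[e']; exact: near_infty_natSinv_lt. Qed.

Let scvg : cvgn s.
Proof.
apply: cauchy_cvg; apply/cauchy_ballP => e e0; near_simpl.
have er : e = (complex.Re e)%:C by rewrite RRe_real// gtr0_real.
have e0' : 0 < complex.Re e by rewrite -ltcR -er.
have e4 : 0 < complex.Re e ^+ 2 / 4 by rewrite divr_gt0// exprn_gt0.
near=> i j => /=.
rewrite -ball_normE /= -hnormE.
rewrite er ltcR.
rewrite -ltr_sqr ?nnegrE ?hnorm_ge0 ?(ltW e0')//.
apply: (le_lt_trans (mid _ _)).
have hi k : J (s k) - m < k.+1%:R^-1 by rewrite ltrBlDl sP.
have : i.+1%:R^-1 < complex.Re e ^+ 2 / 4.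
  by near: i; exact: near_inv e4.
have : j.+1%:R^-1 < complex.Re e ^+ 2 / 4.
  by near: j; exact: near_inv e4.
have := hi i; have := hi j; set x := _^-1; set y := _^-1; move: (J _) (J _) x y (_ ^+ 2) => *; lra.
Unshelve. all: end_near. Qed.

Let h := limn s.

Let close (e : R) : 0 < e -> exists2 k, hnorm (s k - h) < e & J (s k) < m + e.
Proof.
move=> e0; near \oo => k; exists k.
  rewrite -ltcR hnormE distrC; near: k.
  have /cvgrPdist_lt := scvg; apply; by rewrite ltcR.
apply: (lt_le_trans (sP k)); rewrite lerD2l ltW//; near: k.
exact: near_inv e0.
Unshelve. all: end_near. Qed.

Let var v t : 0 <= 2 * t * (rdot h v - phi v) + t ^+ 2 * hnorm v ^+ 2.
Proof.
apply/ler_addgt0Pl => e e0; rewrite addrC -/(_ + _).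
set K := 1 + 2 * `|t| * hnorm v.
have K0 : 0 < K by rewrite ltr_pwDl// !mulr_ge0// hnorm_ge0.
have [k k1 k2] := close (divr_gt0 e0 K0).
have := mJ (s k + t%:C *: v); rewrite JD.
have -> : rdot (s k) v = rdot h v + rdot (s k - h) v by rewrite -rdotDl addrC subrK.
have := CS (s k - h) v.
have : 2 * t * rdot (s k - h) v <= 2 * `|t| * `|rdot (s k - h) v|.
  by rewrite -!mulrA -normrM ler_wpM2l// ler_norm.
set d := rdot (s k - h) v => d1 d2.
have d3 : 2 * `|t| * `|d| <= 2 * `|t| * (hnorm v * (e / K)).
  rewrite ler_wpM2l ?mulr_ge0//; apply: (le_trans d2).
  by rewrite mulrC ler_wpM2l ?hnorm_ge0// ltW.
have : e / K + 2 * `|t| * (hnorm v * (e / K)) = e.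
  by rewrite /K; field; rewrite gt_eqF.
lra.
Qed.

Lemma Riesz_real : exists h0, forall v, phi v = rdot v h0.
Proof.
exists h => v; rewrite rdotC; apply/esym/eqP; rewrite -subr_eq0.
set a := rdot h v - phi v; apply/negPn/negP => a0.
set N := 1 + hnorm v ^+ 2.
have N0 : 0 < N by rewrite ltr_pwDl// sqr_ge0.
have := var v (- a / N); rewrite -/a.
have -> : 2 * (- a / N) * a + (- a / N) ^+ 2 * hnorm v ^+ 2 =
  - (a ^+ 2 * (2 * N - (N - 1)) / N ^+ 2).
  by rewrite /N; field; rewrite gt_eqF.
rewrite oppr_ge0 leNgt => /negP; apply; rewrite divr_gt0 ?exprn_gt0//.
rewrite mulr_gt0//; last by lra.
by rewrite lt_def sqr_ge0 expf_neq0.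
Qed.

End functional.

Lemma adjointP (A : H -> H) : bounded_operator A ->
  forall f g, hdot (A f) g = hdot f (adjoint A g).
Proof.
move=> [lA bA] f g; rewrite /adjoint; case: xgetP => [h _ /(_ f)//|].
pose L := GRing.isLinear.Build _ _ _ _ A lA.
pose Al : {linear H -> H} := HB.pack A L.
have /linear_boundedP/pinfty_ex_gt0 [M M0 AM] : bounded_near Al (nbhs (0 : H)) by [].
have AD x y : A (x + y) = A x + A y by exact: (linearD Al).
have AZ a x : A (a *: x) = a *: A x by exact: (linearZ_LR Al).
have [] := @Riesz_real (fun x => rdot (A x) g) (complex.Re M * hnorm g).
- by move=> x y; rewrite AD rdotDl.
- by move=> t x; rewrite AZ rdotZl.
- move=> x; apply: (le_trans (CS _ _)); rewrite mulrAC ler_wpM2r ?hnorm_ge0//.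
  by rewrite -lecR rmorphM/= !hnormE RRe_real ?gtr0_real//; exact: AM.
move=> h hP /(_ h) []; move=> x /=.
have hPi := hP ('i *: x); have hPx := hP x.
move: hPx hPi; rewrite AZ /rdot !linearZl_LR /=.
case: (hdot (A x) g) (hdot x h) => [a b] [c d] /= -> ; rewrite !mul0r !mul1r !sub0r.
by move=> /oppr_inj ->.
Qed.
End Riesz.

(* Main.v *)
Require Import Defs.
From HB Require Import structures.
From mathcomp Require Import all_boot all_order all_algebra.
From mathcomp Require Import complex lra.
From mathcomp Require Import boolp classical_sets reals topology normedtype.
From mathcomp Require Import sequences.

(* Positivity makes A = Ku and S = Ku + Kw self-adjoint. If S h = A g then
   <g, A f> = <h, S f>, so the vectors A f with ||S f|| <= 1 form a weakly
   bounded, hence bounded, set: ||A f|| <= C ||S f||. For each g, projecting a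
   solution of S h = A g onto the closure of ran S gives the unique solution
   B g lying there, with ||B g|| <= c ||g|| as soon as ||A f|| <= c ||S f|| for
   all f; the best such c is the supremum of the ratios. Then F := B^* solves
   A = F S. Conversely any solution satisfies S F^* = A, so that
   ran F^* `<=` closure (ran S) forces F^* = B. *)

Set Implicit Arguments.
Unset Strict Implicit.
Unset Printing Implicit Defensive.

Import Order.TTheory GRing.Theory Num.Theory.
Import numFieldNormedType.Exports.

Local Open Scope classical_set_scope.
Local Open Scope ring_scope.

(** * The real part of the inner product, and limits in norm *)

Section RealInnerProduct.
Context {R : realType} {H : hilbertType R}.
Implicit Types (f g h v : H) (t : R) (V : set H).
Local Open Scope complex_scope.

Definition rip f g : R := complex.Re (hdot f g).

Lemma hdotC f g : hdot f g = Num.conj (hdot g f).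
Proof. by rewrite (hermC (@hdot R H)) expr0 mul1r. Qed.

Lemma hdotDl f g h : hdot (f + g) h = hdot f h + hdot g h.
Proof. by rewrite linearDl. Qed.

Lemma hdotDr f g h : hdot h (f + g) = hdot h f + hdot h g.
Proof. by rewrite linearD. Qed.

Lemma hdotZl (b : R[i]) f g : hdot (b *: f) g = b * hdot f g.
Proof. by rewrite linearZl_LR. Qed.

Lemma hdotZr (b : R[i]) f g : hdot f (b *: g) = Num.conj b * hdot f g.
Proof. by rewrite linearZr. Qed.

Lemma hdot0r f : hdot f 0 = 0.
Proof. by rewrite -(scale0r (0 : H)) hdotZr rmorph0 mul0r. Qed.

Lemma ripDl f g h : rip (f + g) h = rip f h + rip g h.
Proof. by rewrite /rip hdotDl; case: (hdot f h); case: (hdot g h). Qed.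

Lemma ripC f g : rip f g = rip g f.
Proof. by rewrite /rip hdotC /=; case: (hdot g f). Qed.

Lemma ripDr f g h : rip h (f + g) = rip h f + rip h g.
Proof. by rewrite !(ripC h) ripDl. Qed.

Lemma ripZl t f g : rip (t%:C *: f) g = t * rip f g.
Proof.
by rewrite /rip hdotZl; case: (hdot f g) => a b /=; rewrite mul0r subr0.
Qed.

Lemma ripZr t f g : rip f (t%:C *: g) = t * rip f g.
Proof. by rewrite !(ripC f) ripZl. Qed.

Lemma ripNl f g : rip (- f) g = - rip f g.
Proof. by rewrite -mulN1r -ripZl rmorphN scaleN1r. Qed.

Lemma ripNr f g : rip f (- g) = - rip f g.
Proof. by rewrite !(ripC f) ripNl. Qed.

Lemma rip_sqr f : rip f f = hnorm f ^+ 2.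
Proof. by rewrite /rip hdot_normE -hnormE -rmorphXn. Qed.

Lemma hnorm0 : hnorm (0 : H) = 0.
Proof. by rewrite /hnorm normr0. Qed.

Lemma hnorm_eq0 f : (hnorm f == 0) = (f == 0).
Proof.
apply/eqP/eqP => [f0|->]; rewrite ?hnorm0//.
by apply/normr0_eq0; rewrite -hnormE f0.
Qed.

Lemma hnorm_gt0 f : (0 < hnorm f) = (f != 0).
Proof. by rewrite lt_def hnorm_ge0 andbT hnorm_eq0. Qed.

Lemma hnormD f g : hnorm (f + g) <= hnorm f + hnorm g.
Proof. by rewrite -lecR rmorphD/= !hnormE ler_normD. Qed.

Lemma hnormN f : hnorm (- f) = hnorm f.
Proof. by rewrite /hnorm normrN. Qed.

Lemma hnormZ t f : hnorm (t%:C *: f) = `|t| * hnorm f.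
Proof.
apply: complexI; rewrite rmorphM/= !hnormE normrZ; congr (_ * _).
by rewrite normc_def/= expr0n/= addr0 sqrtr_sqr.
Qed.

(** With [a = hnorm f] and [b = hnorm g], the squared norm of [b f - a g] expands to
    [2 a b (a b - rip f g)]. *)
Lemma rip_le f g : rip f g <= hnorm f * hnorm g.
Proof.
have [->|g0] := eqVneq g 0.
  by rewrite hnorm0 mulr0 /rip hdot0r.
have ng : 0 < hnorm g by rewrite hnorm_gt0.
have [->|f0] := eqVneq f 0.
  by rewrite hnorm0 mul0r ripC /rip hdot0r.
have nf : 0 < hnorm f by rewrite hnorm_gt0.
have := sqr_ge0 (hnorm ((hnorm g)%:C *: f + (- hnorm f)%:C *: g)).
rewrite -rip_sqr ripDl !ripDr !ripZl !ripZr !rip_sqr (ripC g f).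
set a := hnorm f in nf *; set b := hnorm g in ng *; set r := rip f g => h.
have {}h : 0 <= (2 * (a * b)) * (a * b - r) by apply: le_trans h _; lra.
by rewrite -subr_ge0 -(pmulr_rge0 _ (_ : 0 < 2 * (a * b))) ?mulr_gt0.
Qed.

Lemma rip_abs_le f g : `|rip f g| <= hnorm f * hnorm g.
Proof. by rewrite ler_norml lerNl -ripNl -(hnormN f) rip_le hnormN rip_le. Qed.

(** [rip ('i *: f) g] is minus the imaginary part of [hdot f g]. *)
Lemma hdot_rip0 f g : rip f g = 0 -> rip ('i *: f) g = 0 -> hdot f g = 0.
Proof.
rewrite /rip hdotZl; case: (hdot f g) => a b /= ->.
by rewrite !mul0r mul1r sub0r => /eqP; rewrite oppr_eq0 => /eqP ->.
Qed.

Lemma hdot_eq f g : (forall h, hdot h f = hdot h g) -> f = g.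
Proof.
move=> fg; apply/eqP; rewrite -subr_eq0 -hnorm_eq0 -sqrf_eq0 -rip_sqr.
by rewrite ripDr ripNr /rip fg subrr.
Qed.

(** Letting [j] grow in the hypothesis passes the explicit rate on to the limit; both the projection
    and the gliding hump rely on that rate. *)
Lemma cauchy_hnorm (s : nat -> H) (c : nat -> R) :
  (forall i j, (i <= j)%N -> hnorm (s j - s i) <= c i) -> c @ \oo --> 0 ->
  exists l, forall i, hnorm (l - s i) <= c i.
Proof.
move=> sc c0.
have c_lt e : 0 < e -> \forall k \near \oo, c k < e.
  by move=> e0; have /cvgr_lt := c0; apply.
have scvg : cvgn s.
  apply: cauchy_cvg; apply/cauchy_ballP => e e0; near_simpl.
  have er : e = (complex.Re e)%:C by rewrite RRe_real// gtr0_real.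
  have e1 : 0 < complex.Re e by rewrite -ltcR -er.
  near \oo => N.
  have cN : c N < complex.Re e / 2.
    by near: N; apply: c_lt; rewrite divr_gt0.
  near=> i j; rewrite /= -ball_normE /= -hnormE er ltcR.
  have Ni : (N <= i)%N by near: i; exact: nbhs_infty_ge.
  have Nj : (N <= j)%N by near: j; exact: nbhs_infty_ge.
  have := hnormD (s i - s N) (- (s j - s N)).
  rewrite hnormN opprB addrA subrK.
  by have := sc _ _ Ni; have := sc _ _ Nj; lra.
exists (limn s) => i; apply/ler_addgt0Pr => e e0.
near \oo => j.
have ij : (i <= j)%N by near: j; exact: nbhs_infty_ge.
have := hnormD (limn s - s j) (s j - s i); rewrite addrA subrK.
have : hnorm (limn s - s j) < e.
  rewrite -ltcR hnormE; near: j.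
  by have /cvgrPdist_lt := scvg; apply; rewrite ltcR.
by have := sc _ _ ij; lra.
Unshelve. all: end_near. Qed.

Lemma closure_hnormP V f :
  closure V f <-> forall e, 0 < e -> exists2 v, V v & hnorm (f - v) < e.
Proof.
split=> [Vf e e0|Vf B].
  have eC : (0 : R[i]) < e%:C by rewrite ltcR.
  have [v [Vv]] := Vf _ (nbhsx_ballx f _ eC).
  by rewrite -ball_normE /= -hnormE ltcR; exists v.
move=> /nbhs_ballP[e /= e0 eB].
have er : e = (complex.Re e)%:C by rewrite RRe_real// gtr0_real.
have [|v Vv fv] := Vf (complex.Re e); first by rewrite -ltcR -er.
exists v; split=> //; apply: eB.
by rewrite -ball_normE /= -hnormE er ltcR.
Qed.

Lemma rip_closure_le V f g (K : R) : 0 <= K -> closure V f ->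
  (forall v, V v -> rip v g <= K * hnorm v) -> rip f g <= K * hnorm f.
Proof.
move=> K0 /closure_hnormP Vf Vg; apply/ler_addgt0Pr => e e0.
(* Replacing [f] by [v] changes the left side by at most [hnorm g * hnorm (f - v)] and the right
   side by at most [K * hnorm (f - v)]; the 1 keeps the divisor positive. *)
have D0 : 0 < K + hnorm g + 1 by have := hnorm_ge0 g; lra.
have [v Vv fv] := Vf _ (divr_gt0 e0 D0).
have := Vg _ Vv; have := rip_le (f - v) g; rewrite ripDl ripNl.
have : K * hnorm v <= K * (hnorm f + hnorm (f - v)).
  rewrite ler_wpM2l//; have := hnormD f (- (f - v)).
  by rewrite hnormN opprB addrC subrK.
have := hnorm_ge0 g.
have : hnorm (f - v) * (K + hnorm g + 1) <= e.
  by rewrite -ler_pdivlMr// ltW.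
have := hnorm_ge0 (f - v); move: (hnorm _) (hnorm v) (hnorm g) (hnorm f).
move=> x y z w; nra.
Qed.

(** [rip_closure_le] with [K = 0], used for a vector and its opposite, gives a zero real part;
    ['i *: g] handles the imaginary part. *)
Lemma hdot_closure0 V f g : closure V f ->
  (forall v, V v -> hdot v g = 0) -> hdot f g = 0.
Proof.
move=> Vf Vg.
have rip0 h : (forall v, V v -> hdot v h = 0) -> rip f h = 0.
  move=> Vh; apply: le_anti; apply/andP; split.
    rewrite -(mul0r (hnorm f)); apply: rip_closure_le Vf _ => // v Vv.
    by rewrite /rip Vh// mul0r.
  rewrite -oppr_le0 -ripNr -(mul0r (hnorm f)).
  apply: rip_closure_le Vf _ => // v Vv.
  by rewrite ripNr /rip Vh// oppr0 mul0r.
rewrite hdotC hdot_rip0 ?rmorph0//.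
  by rewrite ripC rip0.
by rewrite ripC rip0// => v /Vg vg; rewrite hdotZr vg mulr0.
Qed.

End RealInnerProduct.

(** * Consequences of completeness: projection and uniform boundedness *)

Section Completeness.
Context {R : realType} {H : hilbertType R}.
Implicit Types (f g h v x : H) (V : set H).
Local Open Scope complex_scope.

(** With ratio one third, the terms after [a k] add up to [a k / 2]. *)
Let a (k : nat) : R := 3^-1 ^+ k.

Let a_gt0 k : 0 < a k.
Proof. by rewrite exprn_gt0// invr_gt0. Qed.

Let aS k : 3 * a k.+1 = a k.
Proof. by rewrite /a exprS mulVKf// pnatr_eq0. Qed.

Let cvg_a K : K * a k @[k --> \oo] --> (0 : R).
Proof.
by apply: cvg_geometric; rewrite ger0_norm ?invr_ge0// invf_lt1// ltr1n.
Qed.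

(** [p] is the limit of a sequence in [V] minimizing the distance to [x], hence lies in the closure
    of [V]. *)
Lemma projection V x : V 0 ->
  (forall (b : R[i]) u v, V u -> V v -> V (b *: u + v)) ->
  exists2 p, closure V p & forall v, V v -> hdot v (x - p) = 0.
Proof.
move=> V0 VL.
have VZ (b : R[i]) v : V v -> V (b *: v).
  by move=> Vv; rewrite -(addr0 (b *: v)); exact: VL.
pose D := [set hnorm (x - v) ^+ 2 | v in V].
have D0 : has_inf D.
  split; first by exists (hnorm (x - 0) ^+ 2); exists 0.
  by exists 0 => _ [v _ <-]; rewrite sqr_ge0.
set d := inf D.
have dD v : V v -> d <= hnorm (x - v) ^+ 2.
  by move=> Vv; apply: ge_inf; [case: D0|exists v].
(* With this tolerance, the parallelogram law and the midpoint of [s i] and [s j] bound the squared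
   distance of these points by [(a i ^+ 2 + a j ^+ 2) / 2]. *)
have near_inf k : exists2 v, V v & hnorm (x - v) ^+ 2 < d + a k ^+ 2 / 4.
  have e0 : 0 < a k ^+ 2 / 4 by rewrite divr_gt0// exprn_gt0.
  by have [_ [v Vv <-] ?] := inf_adherent e0 D0; exists v.
pose s k := s2val (cid2 (near_inf k)).
have sV k : V (s k) by rewrite /s; case: cid2.
have sd k : hnorm (x - s k) ^+ 2 < d + a k ^+ 2 / 4 by rewrite /s; case: cid2.
have a_le i j : (i <= j)%N -> a j <= a i.
  by move=> ij; rewrite ler_wiXn2l// ?invr_ge0// invf_le1// ler1n.
have [|p sp] := @cauchy_hnorm R H s (fun k => 1 * a k) _ (cvg_a 1).
  move=> i j ij; rewrite mul1r.
  rewrite -ler_sqr ?nnegrE ?hnorm_ge0 ?(ltW (a_gt0 _))//.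
  have := dD _ (VL 2^-1%:C _ _ (sV i) (VZ 2^-1%:C _ (sV j))).
  have := sd i; have := sd j.
  have : a j ^+ 2 <= a i ^+ 2.
    by rewrite ler_sqr ?nnegrE ?(ltW (a_gt0 _))// a_le.
  rewrite -!rip_sqr !(ripDl, ripDr, ripNl, ripNr, ripZl, ripZr).
  rewrite (ripC (s i) x) (ripC (s j) x) (ripC (s j) (s i)).
  lra.
have rip0 v : V v -> rip v (x - p) <= 0.
  move=> Vv; apply/ler_addgt0Pr => e e0; rewrite add0r.
  (* The three terms absorb, in order, the tolerance, the square of the added [a k *: v], and the
     error from replacing [s k] by [p]. *)
  set K := 1 + hnorm v ^+ 2 + hnorm v.
  have K0 : 0 < K by rewrite ltr_wpDr ?hnorm_ge0// ltr_wpDr ?sqr_ge0.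
  have /cvgr_lt/(_ e e0) := cvg_a K.
  move=> [k _ /(_ k (leqnn k)) /= Ke]; apply: (le_trans _ (ltW Ke)).
  (* Moving s k by a k *: v stays in V, so it gains at most a k ^+ 2 / 4 in
     squared distance to x; hence rip v (x - s k) is at most of order a k. *)
  have := dD _ (VL (a k)%:C _ _ Vv (sV k)).
  have := sd k; have := rip_le v (s k - p).
  rewrite -(hnormN (s k - p)) opprB.
  have : hnorm v * hnorm (p - s k) <= hnorm v * a k.
    by rewrite ler_wpM2l ?hnorm_ge0// -[leRHS]mul1r.
  rewrite -!(rip_sqr (x - _)) !(ripDl, ripDr, ripNl, ripNr, ripZl, ripZr).
  rewrite /K -(rip_sqr v).
  rewrite (ripC (s k) x) (ripC v x) (ripC (s k) v).
  have v0 : 0 <= rip v v by rewrite rip_sqr sqr_ge0.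
  have := a_gt0 k; set t := a k => t0; move: v0.
  move: (rip x x) (rip x v) (rip x (s k)) (rip (s k) (s k)) (rip v v).
  move: (rip v (s k)) (rip v p) => r1 r2 r3 r4 r5 r6 r7.
  move=> v0 h1 h2 h3 h4.
  have h5 : t * (r4 - r1) <= t * (t * (8^-1 + r7 / 2)) by nra.
  have {}h5 : r4 - r1 <= t * (8^-1 + r7 / 2) by rewrite -(ler_pM2l t0).
  by have := mulr_ge0 (ltW t0) v0; lra.
exists p.
  apply/closure_hnormP => e e0; have /cvgr_lt/(_ e e0) := cvg_a 1.
  move=> [k _ /(_ k (leqnn k)) /= ke]; exists (s k) => //.
  by apply: le_lt_trans (sp k) _.
have rip_eq0 v : V v -> rip v (x - p) = 0.
  move=> Vv; apply/le_anti; rewrite rip0//= -oppr_le0 -ripNl rip0//.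
  by rewrite -scaleN1r; exact: VZ.
by move=> v Vv; rewrite hdot_rip0 ?rip_eq0//; exact: VZ.
Qed.

(* Gliding hump (Sokal): from [u k], move by [a k] along [x k] in the direction
   that does not decrease [`|rip _ (x k)|]; the later moves have total length at
   most [a k / 2], so they undo at most half of this contribution. *)
Lemma weakly_bounded_bounded (X : set H) :
  (forall g, exists M, forall x, X x -> `|rip g x| <= M) ->
  exists C, forall x, X x -> hnorm x <= C.
Proof.
move=> Xw; apply: contrapT => /forallNP Xub.
(* This makes the k-th contribution [a k * hnorm (y k)] exceed [k]. *)
have big k : exists2 x, X x & k%:R / a k < hnorm x.
  have /existsNP[x /not_implyP[Xx /negP]] := Xub (k%:R / a k).
  by rewrite -ltNge => xk; exists x.
pose y k := s2val (cid2 (big k)).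
have yX k : X (y k) by rewrite /y; case: cid2.
have ya k : k%:R / a k < hnorm (y k) by rewrite /y; case: cid2.
have y0 k : 0 < hnorm (y k).
  by apply: le_lt_trans (ya k); rewrite divr_ge0// ltW.
pose e k := (a k / hnorm (y k))%:C *: y k.
pose u := fix u k := if k is k'.+1 then
  if 0 <= rip (u k') (y k') then u k' + e k' else u k' - e k' else 0.
have ne k : hnorm (e k) = a k.
  by rewrite hnormZ ger0_norm ?divfK ?gt_eqF// divr_ge0 ?hnorm_ge0// ltW.
have re k : rip (e k) (y k) = a k * hnorm (y k).
  by rewrite ripZl rip_sqr expr2 mulrA divfK ?gt_eqF.
have uS k : hnorm (u k.+1 - u k) <= a k.
  by rewrite /=; case: ifP => _; rewrite addrAC subrr add0r ?hnormN ne.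
have uy k : a k * hnorm (y k) <= `|rip (u k.+1) (y k)|.
  rewrite /=; case: ifPn; rewrite -?ltNge => r0.
    by rewrite ripDl re; apply: le_trans (ler_norm _); rewrite lerDr.
  rewrite ripDl ripNl re -normrN; apply: le_trans (ler_norm _).
  by rewrite opprD opprK lerDr oppr_ge0 ltW.
(* [3 / 2 * a i] is the sum of the geometric tail starting at [a i]. *)
have uij i j : (i <= j)%N -> hnorm (u j - u i) <= 3 / 2 * a i.
  move=> /subnK <-; move: (j - i)%N => n; elim: n i => [|n IH] i.
    by rewrite subrr hnorm0 mulr_ge0 ?divr_ge0// ltW.
  rewrite addSnnS; have := IH i.+1; have := uS i; have := aS i.
  have := hnormD (u (n + i.+1)%N - u i.+1) (u i.+1 - u i).
  by rewrite addrA subrK; lra.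
have [l lu] := cauchy_hnorm uij (cvg_a _).
have [M lM] := Xw l.
(* Half of the n-th contribution survives in the limit, so [rip l (y n)] exceeds [n / 2], hence [M],
   in absolute value. *)
have [n nM] : exists n : nat, 2 * M < n%:R.
  by exists (Num.truncn (2 * M)).+1; rewrite truncnS_gt.
have := lM _ (yX n); apply/negP; rewrite -ltNge.
have h1 := rip_abs_le (l - u n.+1) (y n).
have h2 : hnorm (l - u n.+1) * hnorm (y n) <= a n / 2 * hnorm (y n).
  rewrite ler_wpM2r ?hnorm_ge0//; apply: le_trans (lu n.+1) _.
  by have := aS n; lra.
have h3 : n%:R < a n * hnorm (y n) by rewrite mulrC -ltr_pdivrMr.
have h4 : rip (u n.+1) (y n) = rip l (y n) - rip (l - u n.+1) (y n).
  by rewrite [rip (l - _) _]ripDl ripNl opprD opprK addNKr.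
have := ler_normB (rip l (y n)) (rip (l - u n.+1) (y n)); rewrite -h4.
by have := uy n; lra.
Qed.

End Completeness.

(** * Bounded operators, adjoints and the operator norm *)

Section Operators.
Context {R : realType} {H : hilbertType R}.
Implicit Types (A B : H -> H) (f g h v x : H).
Local Open Scope complex_scope.

Let pack_linear A (lA : linear A) : {linear H -> H} :=
  HB.pack A (GRing.isLinear.Build _ _ _ _ A lA).

Lemma bounded_operatorP A : bounded_operator A <->
  linear A /\ exists2 C : R, 0 <= C & forall f, hnorm (A f) <= C * hnorm f.
Proof.
split=> [] [lA bA]; split=> //.
  have /(@linear_boundedP _ _ _ (pack_linear lA))/pinfty_ex_gt0[M M0 AM] := bA.
  exists (complex.Re M); first by rewrite -lecR RRe_real ?gtr0_real// ltW.
  by move=> f; rewrite -lecR rmorphM/= !hnormE RRe_real ?gtr0_real.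
have [C C0 AC] := bA.
apply/ex_bound; exists C%:C; apply/nbhs_norm0P; exists 1 => //= f /= f1.
rewrite -hnormE lecR; apply: le_trans (AC f) _.
by rewrite ler_piMr// -lecR hnormE ltW.
Qed.

(** Polarization: the quadratic form is real at [f], [g], [f + g] and [f + 'i *: g], which yields
    the imaginary and real parts of the identity. *)
Lemma nonneg_selfadjoint A : linear A -> nonneg_operator A ->
  forall f g, hdot (A f) g = hdot f (A g).
Proof.
move=> lA A0 f g.
have AD u v : A (u + v) = A u + A v := linearD (pack_linear lA) u v.
have AZ (b : R[i]) u : A (b *: u) = b *: A u := linearZ_LR (pack_linear lA) b u.
have im0 h : complex.Im (hdot (A h) h) = 0.
  by have := A0 h; rewrite lecE => /andP[/eqP].
have := im0 (f + g); have := im0 (f + 'i *: g).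
rewrite !AD AZ !(hdotDl, hdotDr, hdotZl, hdotZr) /=.
have := im0 f; have := im0 g; rewrite (hdotC f).
case: (hdot (A f) f) => [? ?]; case: (hdot (A g) g) => [? ?].
case: (hdot (A f) g) => [p q]; case: (hdot (A g) f) => [r s] /=.
move=> -> -> h1 h2; apply/eqP; rewrite eq_complex /=.
by apply/andP; split; apply/eqP; lra.
Qed.

Lemma adjoint_eq A B : (forall f g, hdot (A f) g = hdot f (B g)) ->
  adjoint A = B.
Proof.
move=> AB; apply/funext => g; rewrite /adjoint; case: xgetP => [h _ hP|].
  by apply: hdot_eq => f; rewrite -hP AB.
by move=> /(_ (B g))[].
Qed.

(** For [h = adjoint A f], the square of [hnorm h] is [rip (A h) f], at most
    [C * hnorm h * hnorm f]; divide by [hnorm h]. *)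
Lemma adjoint_le A (C : R) : bounded_operator A ->
  (forall f, hnorm (A f) <= C * hnorm f) ->
  forall f, hnorm (adjoint A f) <= C * hnorm f.
Proof.
move=> bA AC f; set h := adjoint A f.
have [->|h0] := eqVneq (hnorm h) 0.
  by have := AC f; apply: le_trans; exact: hnorm_ge0.
have hp : 0 < hnorm h by rewrite lt_def h0 hnorm_ge0.
rewrite -(ler_pM2r hp) -expr2 -rip_sqr /rip -adjointP//.
apply: (le_trans (rip_le _ _)); rewrite mulrAC ler_wpM2r ?hnorm_ge0//.
Qed.

Lemma adjointK A : bounded_operator A -> adjoint (adjoint A) = A.
Proof.
by move=> bA; apply: adjoint_eq => f g; rewrite hdotC -adjointP// -hdotC.
Qed.

Lemma bounded_adjoint A : bounded_operator A -> bounded_operator (adjoint A).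
Proof.
move=> bA; apply/bounded_operatorP; split; last first.
  have /bounded_operatorP[_ [C C0 AC]] := bA.
  by exists C => //; exact: adjoint_le.
move=> b f g; apply: hdot_eq => h.
by rewrite hdotDr hdotZr -!adjointP// hdotDr hdotZr.
Qed.

Lemma has_ubound_opnorm A : bounded_operator A ->
  has_ubound [set hnorm (A f) | f in [set f | hnorm f <= 1]].
Proof.
move=> /bounded_operatorP[_ [C C0 AC]]; exists C => _ [f f1 <-].
by apply: le_trans (AC f) _; rewrite ler_piMr.
Qed.

Lemma le_opnorm A f : bounded_operator A -> hnorm (A f) <= opnorm A * hnorm f.
Proof.
move=> bA; have [lA _] := bA.
have AZ (b : R[i]) u : A (b *: u) = b *: A u := linearZ_LR (pack_linear lA) b u.
have [->|f0] := eqVneq f 0.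
  by rewrite -(scale0r (0 : H)) AZ !scale0r hnorm0 mulr0.
have nf : 0 < hnorm f by rewrite hnorm_gt0.
rewrite -ler_pdivrMr// mulrC.
have -> : (hnorm f)^-1 * hnorm (A f) = hnorm (A ((hnorm f)^-1%:C *: f)).
  by rewrite AZ hnormZ ger0_norm// invr_ge0 ltW.
apply: ub_le_sup; first exact: has_ubound_opnorm.
eexists; last reflexivity.
by rewrite /= hnormZ ger0_norm ?invr_ge0 ?(ltW nf)// mulVf ?gt_eqF.
Qed.

Lemma opnorm_ge0 A : bounded_operator A -> 0 <= opnorm A.
Proof.
move=> bA; apply: le_trans (hnorm_ge0 (A 0)) _.
apply: ub_le_sup; first exact: has_ubound_opnorm.
by exists 0; rewrite //= hnorm0.
Qed.

Lemma opnorm_le A (C : R) : 0 <= C ->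
  (forall f, hnorm (A f) <= C * hnorm f) -> opnorm A <= C.
Proof.
move=> C0 AC; apply: ge_sup.
  by exists (hnorm (A 0)); exists 0; rewrite //= hnorm0.
by move=> _ [f f1 <-]; apply: le_trans (AC f) _; rewrite ler_piMr.
Qed.

End Operators.

(** * Factoring a symmetric operator through another of larger range *)

Section Factorization.
Context {R : realType} {H : hilbertType R}.
Variables A S : {linear H -> H}.
Hypothesis A_sym : forall f g, hdot (A f) g = hdot f (A g).
Hypothesis S_sym : forall f g, hdot (S f) g = hdot f (S g).
Hypothesis rangeAS : range A `<=` range S.
Local Open Scope complex_scope.

Let SA g : exists h, S h = A g.
Proof. by have [h _ Sh] := rangeAS (imageT A g); exists h. Qed.

(** If [S h = A g], then [hdot g (A f) = hdot (S h) f = hdot h (S f) = 0]. *)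
Lemma ker_subset_of_range f : S f = 0 -> A f = 0.
Proof.
move=> Sf; apply: hdot_eq => g; have [h Sh] := SA g.
by rewrite -A_sym -Sh S_sym Sf !hdot0r.
Qed.

Lemma range_norm_le : exists C, forall f, hnorm (A f) <= C * hnorm (S f).
Proof.
have [|C CX] :=
  @weakly_bounded_bounded R H [set A f | f in [set f | hnorm (S f) <= 1]].
  (* The bound [hnorm h] depends on [g]; uniform boundedness removes this dependence. *)
  move=> g; have [h Sh] := SA g; exists (hnorm h) => _ [f Sf <-].
  rewrite /rip -A_sym -Sh S_sym -/(rip _ _).
  by apply: le_trans (rip_abs_le _ _) _; rewrite ler_piMr ?hnorm_ge0.
exists C => f; have [Sf|Sf] := eqVneq (S f) 0.
  by rewrite Sf ker_subset_of_range// hnorm0 mulr0.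
have nSf : 0 < hnorm (S f) by rewrite hnorm_gt0.
have nV : `|(hnorm (S f))^-1| = (hnorm (S f))^-1.
  by rewrite ger0_norm// invr_ge0 ltW.
rewrite -ler_pdivrMr// mulrC -nV -hnormZ -linearZ_LR; apply: CX.
eexists; last reflexivity.
by rewrite /= linearZ_LR hnormZ nV mulVf ?gt_eqF.
Qed.

Lemma closure_range_perp h w : closure (range S) h -> S w = 0 -> hdot h w = 0.
Proof.
move=> hS Sw; apply: hdot_closure0 hS _ => _ [f _ <-].
by rewrite S_sym Sw hdot0r.
Qed.

(** [h - k] lies in the kernel of [S] and is orthogonal to it, hence to itself. *)
Lemma closure_range_inj h k : closure (range S) h -> closure (range S) k ->
  S h = S k -> h = k.
Proof.
move=> hS kS Shk; have Sw : S (h - k) = 0 by rewrite linearB Shk subrr.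
apply/eqP; rewrite -subr_eq0 -hnorm_eq0 -sqrf_eq0 -rip_sqr ripDl ripNl.
by rewrite /rip !closure_range_perp// subrr.
Qed.

(** Since [hdot (S f) h = hdot (A f) g], pairing with [h] is bounded by [c * hnorm g] on the range
    of [S], hence on its closure, which contains [h] itself. *)
Lemma solution_norm_le (c : R) g h : 0 <= c ->
  (forall f, hnorm (A f) <= c * hnorm (S f)) ->
  closure (range S) h -> S h = A g -> hnorm h <= c * hnorm g.
Proof.
move=> c0 AS hS Sh; have [->|h0] := eqVneq h 0.
  by rewrite hnorm0 mulr_ge0 ?hnorm_ge0.
rewrite -(ler_pM2r (_ : 0 < hnorm h)) ?hnorm_gt0// -expr2 -rip_sqr.
apply: rip_closure_le hS _; first by rewrite mulr_ge0 ?hnorm_ge0.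
move=> _ [f _ <-]; rewrite /rip S_sym Sh -A_sym -/(rip _ _).
apply: le_trans (rip_le _ _) _.
by rewrite mulrAC ler_wpM2r ?hnorm_ge0.
Qed.

Lemma closure_range_solution : exists B : H -> H, [/\ linear B,
  forall g, S (B g) = A g & forall g, closure (range S) (B g)].
Proof.
have sol g : exists p, closure (range S) p /\ S p = A g.
  have [h Sh] := SA g.
  have [||p pS ph] := @projection R H (range S) h.
  - by exists 0; rewrite ?linear0.
  - by move=> b _ _ [u _ <-] [v _ <-]; exists (b *: u + v); rewrite // linearP.
  (* [h - p] is orthogonal to the range of the symmetric [S], so [S] kills it. *)
  exists p; split=> //; rewrite -Sh; apply/esym/hdot_eq => f.
  by apply/eqP; rewrite -!S_sym -subr_eq0 -linearB /= ph//; exists f.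
have [B BP] := choice sol.
exists B; split=> [b f g|g|g]; try by case: (BP g).
have SB x : S (B x) = A x by case: (BP x).
have perp x w : S w = 0 -> hdot (B x) w = 0.
  by apply: closure_range_perp; case: (BP x).
(* The linearity defect [w] is in the kernel of [S], and every value of [B] is orthogonal to that
   kernel, so [hdot w w = 0]. *)
set w := B (b *: f + g) - (b *: B f + B g).
have Sw : S w = 0 by rewrite linearB /= linearP !SB linearP subrr.
apply/eqP; rewrite -subr_eq0 -hnorm_eq0 -sqrf_eq0 -rip_sqr /rip -/w.
rewrite {1}/w -scaleN1r !(hdotDl, hdotZl) !perp//.
by rewrite !(mulr0, addr0).
Qed.

Lemma factorization_exists_unique :
  exists! F : H -> H,
    [/\ bounded_operator F,
        A = F \o S :> (H -> H),
        range (adjoint F) `<=` closure (range S),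
        ker (adjoint F) = ker A
      & opnorm F =
        sup [set hnorm (A f) / hnorm (S f) |
             f in [set f | hnorm f = 1 /\ S f != 0]]].
Proof.
set ratios := [set hnorm _ / _ | _ in _]; set c := sup ratios.
have [C AC] := range_norm_le.
have ratios_ub : has_ubound ratios.
  by exists C => _ [f [_ Sf] <-]; rewrite ler_pdivrMr ?hnorm_gt0.
have ratios_c f : hnorm f = 1 -> S f != 0 -> hnorm (A f) / hnorm (S f) <= c.
  by move=> f1 Sf; apply: ub_le_sup => //; exists f.
have c0 : 0 <= c.
  have [[_ [f [f1 Sf] _]]|r0] := pselect (ratios !=set0).
    by apply: le_trans (ratios_c f f1 Sf); rewrite divr_ge0 ?hnorm_ge0.
  (* Without ratios, [sup] takes its default value 0. *)
  have -> : c = 0; last by [].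
  by rewrite /c sup_out// => -[].
have Ac f : hnorm (A f) <= c * hnorm (S f).
  have [Sf|Sf] := eqVneq (S f) 0.
    by rewrite Sf (ker_subset_of_range Sf) hnorm0 mulr0.
  have f0 : 0 < hnorm f.
    by rewrite hnorm_gt0; apply: contraNneq Sf => ->; rewrite linear0.
  have nV : `|(hnorm f)^-1| = (hnorm f)^-1 by rewrite ger0_norm// invr_ge0 ltW.
  rewrite -ler_pdivrMr ?hnorm_gt0//.
  (* The ratio is invariant under scaling, so [f] may be normalized. *)
  have := ratios_c (((hnorm f)^-1)%:C *: f).
  rewrite !linearZ_LR !hnormZ nV mulVf ?gt_eqF//.
  rewrite -mulf_div divff ?mul1r ?invr_eq0 ?gt_eqF//; apply => //.
  by rewrite -hnorm_gt0 hnormZ nV mulr_gt0 ?invr_gt0// hnorm_gt0.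
have [B [lB SB BS]] := closure_range_solution.
have Bc g : hnorm (B g) <= c * hnorm g.
  exact: solution_norm_le.
have bB : bounded_operator B by apply/bounded_operatorP; split=> //; exists c.
(* This is the adjoint of the equation [A = F S] for symmetric [A] and [S]. *)
have adjF F : bounded_operator F -> A = F \o S :> (H -> H) ->
    forall g, S (adjoint F g) = A g.
  move=> bF AF g; apply: hdot_eq => f.
  rewrite -S_sym -adjointP//; have -> : F (S f) = A f by rewrite AF.
  exact: A_sym.
have FP : [/\ bounded_operator (adjoint B),
    A = adjoint B \o S :> (H -> H),
    range (adjoint (adjoint B)) `<=` closure (range S),
    ker (adjoint (adjoint B)) = ker A
  & opnorm (adjoint B) = c].
  have bF := bounded_adjoint bB.
  have AF : A = adjoint B \o S :> (H -> H).
    apply/funext => f; apply: hdot_eq => g /=.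
    by rewrite -adjointP// -S_sym SB -A_sym.
  rewrite adjointK//; split=> //.
  - by move=> _ [g _ <-].
  - apply/seteqP; split=> g /=; rewrite /ker /=.
      by move=> Bg; rewrite -[LHS](SB g) Bg linear0.
    move=> Ag; apply: closure_range_inj => //.
      by apply: subset_closure; exists 0; rewrite ?linear0.
    by rewrite SB Ag linear0.
  (* The upper bound [c] passes from [B] to its adjoint; conversely [A f = adjoint B (S f)] bounds
     every ratio by the operator norm. *)
  apply/le_anti; rewrite opnorm_le//=; last exact: adjoint_le.
  have [rn0|r0] := pselect (ratios !=set0); last first.
    rewrite /c sup_out; last by case.
    exact: opnorm_ge0.
  apply: ge_sup => // _ [f [_ Sf] <-].
  rewrite ler_pdivrMr ?hnorm_gt0//.
  have -> : A f = adjoint B (S f) by rewrite AF.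
  exact: le_opnorm.
(* [adjoint F'] and [B] both solve [S X = A] with values in the closure of the range, where [S] is
   injective; taking adjoints again recovers [F']. *)
exists (adjoint B); split=> // F' [bF' AF' F'S _ _].
rewrite -(adjointK bF'); congr adjoint; apply/funext => g.
by apply: closure_range_inj => //; rewrite ?SB ?adjF//; apply: F'S; exists g.
Qed.

End Factorization.

(* In the last condition, sup set0 = 0 is the stated convention for the case
   where there is no admissible f; the set of ratios is always bounded here,
   by opnorm F, because Ku = F (Ku + Kw) with F bounded. *)
Theorem proposition5p14 (R : realType) (H : hilbertType R) (Ku Kw : H -> H)
  (hKu : bounded_operator Ku) (hKw : bounded_operator Kw)
  (Ku_ge0 : nonneg_operator Ku) (Kw_ge0 : nonneg_operator Kw)
  (hran : range Ku `<=` range (Ku \+ Kw)) :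
  (exists F : H -> H, bounded_operator F /\ Ku = F \o (Ku \+ Kw)) /\
  exists! F : H -> H,
    [/\ bounded_operator F,
        Ku = F \o (Ku \+ Kw),
        range (adjoint F) `<=` closure (range (Ku \+ Kw)),
        ker (adjoint F) = ker Ku
      & opnorm F =
        sup [set hnorm (Ku f) / hnorm ((Ku \+ Kw) f) |
             f in [set f | hnorm f = 1 /\ (Ku \+ Kw) f != 0]]].
Proof.
have [lKu _] := hKu; have [lKw _] := hKw.
pose A : {linear H -> H} := HB.pack Ku (GRing.isLinear.Build _ _ _ _ Ku lKu).
pose W : {linear H -> H} := HB.pack Kw (GRing.isLinear.Build _ _ _ _ Kw lKw).
have A_sym f g : hdot (A f) g = hdot f (A g).
  exact: (nonneg_selfadjoint lKu Ku_ge0).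
have S_sym f g : hdot ((A \+ W) f) g = hdot f ((A \+ W) g).
  by rewrite /= hdotDl hdotDr A_sym (nonneg_selfadjoint lKw Kw_ge0).
have [F FP] := factorization_exists_unique A_sym S_sym hran.
by split; [exists F; case: FP => -[]|exists F].
Qed.
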